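(* Let $\mathbf e_n=(1,\dots,1)$ be the $n$-dimensional row vector with all entries $1$ and let $\mathbf v_n=(1,t,\dots,t^{n-1})^T$ be an $n$-dimensional column vector. For any string link $T\in\mathrm{Str}(n)$, $$\mathbf e_n\,\mathcal R_n(T)=\mathbf e_n\qquad\text{and}\qquad \mathcal R_n(T)\,\mathbf v_n=\mathbf v_n .$$
   Context: Tangles and string links. Tangles are oriented tangles in $\mathbb R\times[0,1]$ (presented by diagrams, up to isotopy and Reidemeister moves). A tangle $T:\iota^n\to\iota^n$ has bottom endpoints $(1,0),\dots,(n,0)$ and top endpoints $(1,1),\dots,(n,1)$, with the strands oriented upwards at all endpoints. A string link on $n$ strands is a tangle $\iota^n\to\iota^n$ consisting of precisely $n$ interval components (and no closed components), each having one endpoint at the bottom and the other at the top (the permutation of endpoints is arbitrary). String links form a monoid $\mathrm{Str}(n)$ under stacking. Random walk invariant $\mathcal R_n$ (Lin–Tian–Wang). An admissible path in a diagram of $T\in\mathrm{Str}(n)$ starts at a bottom point $(i,0)$, ends at a top point $(j,1)$, and follows the diagram along its orientation. When it reaches a crossing along the undercrossing piece, it must continue along that piece. When it reaches a crossing along the overcrossing piece, it may either continue along it or switch to the undercrossing piece and continue in the direction of the latter. Crossings may be passed repeatedly. The weight $w(P)$ of an admissible path $P$ is the product over all crossing passages (with repetition) of: $1$ if the crossing is approached along the undercrossing piece; $t$ if the crossing is positive, approached along the overcrossing piece, and $P$ continues along it; $1-t$ if the crossing is positive, approached along the overcrossing piece, and $P$ switches; $t^{-1}$, respectively $1-t^{-1}$,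 in the corresponding cases for a negative crossing. (A crossing is positive if, with both strands pointing upwards, the overcrossing strand goes from lower left to upper right.) $\mathcal R_n(T)$ is the $n\times n$ matrix with $(j,i)$ entry $\mathcal R_n(T)_{j,i}=\sum_P w(P)$, summing over all admissible paths $P$ from $(i,0)$ to $(j,1)$ ($0$ if there are none). For $t$ sufficiently close to $1$ the sums converge to rational functions of $t$, independent of the diagram (Lin–Tian–Wang), so $\mathcal R_n(T)$ is a matrix over $\mathbb Q(t)$. *)

(* Defs.v *)
From HB Require Import structures.
From mathcomp Require Import all_boot all_order all_algebra finmap.
From mathcomp Require Import all_classical all_reals all_analysis.
From mathcomp Require Import summability.

Set Implicit Arguments.
Unset Strict Implicit.
Unset Printing Implicit Defensive.

Import Order.TTheory GRing.Theory Num.Theory.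
Import numFieldNormedType.Exports.

Local Open Scope ring_scope.
Local Open Scope classical_set_scope.

(* Tangle diagrams are taken in generic (Morse) position with respect to the
   vertical direction and are cut into horizontal slices, listed from bottom to
   top, each of which contains vertical strands and exactly one of:
   - [Crossing k b]: the strands at positions k and k+1 cross; [b] tells whether
     the piece "/" (lower left to upper right) passes over the piece "\";
   - [Cup k o]: a local minimum, whose two upper ends are at positions k and k+1;
     [o] tells whether the left one is oriented upwards;
   - [Cap k]: a local maximum, joining the lower points at positions k and k+1.
   Positions are counted from 0. *)
Inductive slice :=
  | Crossing of nat & bool
  | Cup of nat & bool
  | Cap of nat.

Definition diagram := seq slice.

(* A horizontal level line meets the diagram in a sequence of oriented points,
   encoded from left to right by [true] (upwards) or [false] (downwards).
   [fits g s]: [g] can be put on top of a level with orientations [s];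
   [above g s]: the orientations of the level above [g]. *)
Definition fits (g : slice) (s : seq bool) : bool :=
  match g with
  | Crossing k _ => (k.+1 < size s)%N
  | Cup k _ => (k <= size s)%N
  | Cap k => (k.+1 < size s)%N && (nth true s k != nth true s k.+1)
  end.

Definition above (g : slice) (s : seq bool) : seq bool :=
  match g with
  | Crossing k _ => take k s ++ nth true s k.+1 :: nth true s k :: drop k.+2 s
  | Cup k o => take k s ++ o :: ~~ o :: drop k s
  | Cap k => take k s ++ drop k.+2 s
  end.

Definition slice_at (D : diagram) (l : nat) : slice := nth (Cap 0) D l.

(* Level l lies below slice l; level 0 is the bottom line, with n upward
   endpoints, and level [size D] is the top line. *)
Definition level (n : nat) (D : diagram) (l : nat) : seq bool :=
  foldl (fun s g => above g s) (nseq n true) (take l D).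

(* D is an oriented tangle diagram with n upward endpoints at the bottom and n
   upward endpoints at the top. *)
Definition tangle_diagram (n : nat) (D : diagram) : Prop :=
  (forall l, (l < size D)%N -> fits (slice_at D l) (level n D l)) /\
  level n D (size D) = nseq n true.

(* (l, p) is the p-th point on level l. *)
Definition lpoint := (nat * nat)%type.

Definition points (n : nat) (D : diagram) : seq lpoint :=
  [seq (l, p) | l <- iota 0 (size D).+1, p <- iota 0 (size (level n D l))].

Definition upwards (n : nat) (D : diagram) (x : lpoint) : bool :=
  nth true (level n D x.1) x.2.

(* A port of a slice is (false, p), the p-th point of its lower line, or
   (true, p), the p-th point of its upper line. *)
Definition port := (bool * nat)%type.

(* The other end of the piece of strand of [g] ending at [e]. *)
Definition across (g : slice) (e : port) : port :=
  let: (b, p) := e in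
  match g with
  | Crossing k _ =>
      (~~ b, if p == k then k.+1 else if p == k.+1 then k else p)
  | Cup k _ =>
      if b then
        if p == k then (true, k.+1) else if p == k.+1 then (true, k)
        else (false, if (p < k)%N then p else (p - 2)%N)
      else (true, if (p < k)%N then p else p.+2)
  | Cap k =>
      if b then (false, if (p < k)%N then p else p.+2)
      else
        if p == k then (false, k.+1) else if p == k.+1 then (false, k)
        else (true, if (p < k)%N then p else (p - 2)%N)
  end.

Definition on_over (g : slice) (e : port) : bool :=
  match g with
  | Crossing k true => (e == (false, k)) || (e == (true, k.+1))
  | Crossing k false => (e == (false, k.+1)) || (e == (true, k))
  | _ => false
  end.

(* The end at which the undercrossing piece leaves the crossing, where [s] gives
   the orientations on the lower line (the value on other slices is junk). *)
Definition under_exit (g : slice) (s : seq bool) : port :=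
  match g with
  | Crossing k b =>
      let e := (false, if b then k.+1 else k) in
      if nth true s e.2 then across g e else e
  | _ => (true, 0%N)
  end.

(* When both pieces point up, or both point down, the crossing is positive iff
   "/" is the overcrossing piece; reversing one of them changes the sign. *)
Definition positive (g : slice) (s : seq bool) : bool :=
  if g is Crossing k b then b == (nth true s k == nth true s k.+1) else false.

(* A walker at x follows the orientation: it enters the slice above x if x is
   oriented upwards, and the slice below x otherwise. *)
Definition next_slice (n : nat) (D : diagram) (x : lpoint) : nat :=
  if upwards n D x then x.1 else x.1.-1.

Definition entry (n : nat) (D : diagram) (x : lpoint) : port :=
  (~~ upwards n D x, x.2).

Definition port_point (l : nat) (e : port) : lpoint := ((l + e.1)%N, e.2).

Definition follows (n : nat) (D : diagram) (x y : lpoint) : bool :=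
  let l := next_slice n D x in
  (l < size D)%N && (y == port_point l (across (slice_at D l) (entry n D x))).

Definition overcrosses (n : nat) (D : diagram) (x : lpoint) : bool :=
  let l := next_slice n D x in
  (l < size D)%N && on_over (slice_at D l) (entry n D x).

Definition switches (n : nat) (D : diagram) (x y : lpoint) : bool :=
  let l := next_slice n D x in
  overcrosses n D x &&
  (y == port_point l (under_exit (slice_at D l) (level n D l))).

(* c lists the successive points of an interval component that runs from a
   bottom endpoint to a top endpoint. *)
Definition strand (n : nat) (D : diagram) (c : seq lpoint) : Prop :=
  exists (i j : 'I_n) (p : seq lpoint),
    [/\ c = (0%N, val i) :: p,
        path (follows n D) (0%N, val i) p
      & last (0%N, val i) p = (size D, val j)].

(* The points of the diagram are partitioned into exactly n strands; a closed
   component would contain points that lie on no strand. *)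
Definition string_link (n : nat) (D : diagram) : Prop :=
  tangle_diagram n D /\
  exists c : n.-tuple (seq lpoint),
    (forall s, s \in c -> strand n D s) /\
    perm_eq (flatten c) (points n D).

Definition admissible_step (n : nat) (D : diagram) (x y : lpoint) : bool :=
  follows n D x y || switches n D x y.

(* A path is recorded by the points (other than the starting point) at which it
   meets the level lines. *)
Definition admissible_path (n : nat) (D : diagram) (i j : nat)
    (P : seq lpoint) : bool :=
  path (admissible_step n D) (0%N, i) P && (last (0%N, i) P == (size D, j)).

Definition step_weight (R : realType) (n : nat) (D : diagram) (t : R)
    (x y : lpoint) : R :=
  if overcrosses n D x then
    let l := next_slice n D x in
    let w := if positive (slice_at D l) (level n D l) then t else t^-1 in
    if follows n D x y then w else 1 - w
  else 1.

Definition path_weight (R : realType) (n : nat) (D : diagram) (t : R) (i : nat)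
    (P : seq lpoint) : R :=
  \prod_(e <- zip ((0%N, i) :: P) P) step_weight n D t e.1 e.2.

(* The sum of the weights of all admissible paths from (i,0) to (j,1) converges
   unconditionally to s, i.e. along the finite sets of paths ordered by
   inclusion; the terms at non-admissible sequences are 0. *)
Definition path_sum_cvg (R : realType) (n : nat) (D : diagram) (t : R)
    (i j : nat) (s : R) : Prop :=
  partial_sum (fun P : seq lpoint =>
    if admissible_path n D i j P then path_weight n D t i P else 0)
    @ totally --> s.

Definition ratfun := {fraction {poly rat}}.

Definition fracX : ratfun := @FracField.tofrac {poly rat} 'X.

(* For t near 1, the value f(t) of the rational function f is defined and
   satisfies g t. *)
Definition eval_near1 (R : realType) (f : ratfun) (g : R -> R -> Prop) : Prop :=
  exists p q : {poly rat},
    f = @FracField.tofrac {poly rat} p / @FracField.tofrac {poly rat} q /\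
    \forall t \near (1 : R),
      (map_poly ratr q).[t] != 0 /\
      g t ((map_poly ratr p).[t] / (map_poly ratr q).[t]).

Definition is_random_walk (R : realType) (n : nat) (D : diagram)
    (M : 'M[ratfun]_n) : Prop :=
  forall j i : 'I_n,
    eval_near1 (M j i) (fun t : R => path_sum_cvg n D t i j).

(* The matrix over Q(t) to whose entries the path sums converge for t near 1.
   The default value 0 is only returned if there is no such matrix. *)
Definition random_walk (R : realType) (n : nat) (D : diagram) : 'M[ratfun]_n :=
  xget 0 [set M | is_random_walk R D M].

Definition evec (n : nat) : 'rV[ratfun]_n := \row_i 1.

Definition vvec (n : nat) : 'cV[ratfun]_n := \col_i fracX ^+ i.

(* Main.v *)
Require Import Defs.
From mathcomp Require Import all_boot all_order all_algebra finmap.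
From mathcomp Require Import all_classical all_reals all_analysis.
From mathcomp Require Import summability.
From mathcomp Require Import ring lra zify.
Import Order.TTheory GRing.Theory Num.Theory.
Import numFieldNormedType.Exports.
Set Implicit Arguments.
Unset Strict Implicit.
Unset Printing Implicit Defensive.
Local Open Scope ring_scope.

(** Each entry of the matrix is a sum over walks on the finite set of points
    where the diagram meets the level lines: from a point the walk makes a
    transition to the next point of its strand or, on an overcrossing piece,
    possibly to the exit of the undercrossing piece.  Let A = A(t) be the matrix
    of transition weights.  A sum over walks from x to y is an entry of
    1 + A + A^2 + ..., that is, of the Green matrix G = (1 - A)^-1.  Both
    identities are obtained by exhibiting a vector whose image under 1 - A is
    supported on one end of the diagram.

    On the right, the two weights at an overcrossing are w and 1 - w, so the
    rows of A sum to 1, except that those of the top points vanish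
    ([transition_row]).  Hence 1 - A maps the constant vector 1 to the indicator
    of the top line, and G maps that indicator back to 1: this is e R = e.

    On the left, number the regions of the diagram from left to right by
    Alexander's rule, adding 1 when an upward strand is passed and subtracting 1
    when a downward one is, and give a point the value t^a, where a is the
    smaller of the numbers of the two regions it separates ([flux]).  This is a
    local conservation law: at every slice the value of an outgoing end is the
    weighted sum of the values of the ingoing ends from which it is reached
    ([flux_balance]).  So the row vector of the values is left invariant by A
    except at the bottom line, which no transition enters ([transition_col]).
    Its entries on the bottom and the top line are 1, t, ..., t^(n-1), and
    multiplying by G gives R v = v.

    It remains to see that the walk sums converge for t near 1 to rational
    functions whose matrix is the corresponding block of G.  At t = 1 the walk
    follows the strands, and in a string link each strand reaches the top in
    finitely many steps ([rank_exists]).  With h(x) = 2^r(x), r being the number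
    of remaining steps, |A(t)| h <= (3/4) h for all t near 1
    ([contracting_near1]): following the strand halves h, and switching has a
    weight near 0.  This inequality makes 1 - A(t) invertible
    ([contracting_unit]) and bounds the total absolute weight of the walks of
    length m by a multiple of (3/4)^m, whence unconditional convergence to the
    entries of G ([path_sum_green]).  By Cramer's rule applied to the
    polynomial matrix X (1 - A(X)), these entries are values of rational
    functions ([green_ratio]), which are determined by their values near 1
    ([eval_near1_uniq]).  The linear algebra is done over an arbitrary field so
    that it applies both to the real numbers and to the rational functions. *)

(** * Sums over duplicate-free sequences *)

Lemma sum_delta (V : nmodType) (T : eqType) (r : seq T) (a : T) (F : T -> V) :
  uniq r -> a \in r -> \sum_(x <- r) (if x == a then F x else 0) = F a.
Proof.
move=> ur ar; rewrite (bigD1_seq a) //= eqxx big1 ?addr0 // => x /negbTE->.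
by [].
Qed.

Lemma ler_sum_subset (R : numDomainType) (T : eqType) (r s : seq T)
    (F : T -> R) :
  uniq r -> uniq s -> {subset r <= s} -> (forall y, 0 <= F y) ->
  \sum_(y <- r) F y <= \sum_(y <- s) F y.
Proof.
move=> ur us sub F0.
have eq_r : perm_eq [seq y <- s | y \in r] r.
  apply: uniq_perm => //; first exact: filter_uniq.
  by move=> y; rewrite mem_filter /=; case: (boolP (y \in r)) => //= /sub.
rewrite [leRHS](bigID (mem r)) /= -[X in _ <= X + _]big_filter.
by rewrite (perm_big _ eq_r) /= lerDl sumr_ge0.
Qed.

(** * Ports of a slice *)

Definition line (g : slice) (s : seq bool) (b : bool) : seq bool :=
  if b then above g s else s.

Definition valid_port g s (e : port) : bool := (e.2 < size (line g s e.1))%N.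

(** The strand ending at the port is oriented into the slice: a lower port has
    [e.1 = false] and must point up, an upper one must point down. *)
Definition inward g s (e : port) : bool := nth true (line g s e.1) e.2 != e.1.

(** Splitting the lower line around the event of the slice replaces all index
    computations by list concatenations. *)
Variant fits_spec : slice -> seq bool -> seq bool -> Prop :=
  | FitsCrossing b s1 x y s2 :
      fits_spec (Crossing (size s1) b) (s1 ++ x :: y :: s2)
        (s1 ++ y :: x :: s2)
  | FitsCup o s1 s2 :
      fits_spec (Cup (size s1) o) (s1 ++ s2) (s1 ++ o :: ~~ o :: s2)
  | FitsCap x s1 s2 :
      fits_spec (Cap (size s1)) (s1 ++ x :: ~~ x :: s2) (s1 ++ s2).

Lemma cat_take_pair (s : seq bool) k : (k.+1 < size s)%N ->
  s = take k s ++ nth true s k :: nth true s k.+1 :: drop k.+2 s.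
Proof.
move=> lt_k.
rewrite -[LHS](cat_take_drop k s) (drop_nth true) ?(drop_nth true lt_k) //.
exact: ltnW.
Qed.

Lemma fitsP g s : fits g s -> fits_spec g s (above g s).
Proof.
case: g => [k b|k o|k] /=.
- move=> lt_k; move: (cat_take_pair lt_k) (size_takel (ltnW (ltnW lt_k))).
  move: (take k s) (nth true s k) (nth true s k.+1) (drop k.+2 s).
  by move=> s1 x y s2 -> <-; apply: FitsCrossing.
- move=> le_k; move: (esym (cat_take_drop k s)) (size_takel le_k).
  move: (take k s) (drop k s) => s1 s2 -> <-; exact: FitsCup.
- case/andP=> lt_k.
  move: (cat_take_pair lt_k) (size_takel (ltnW (ltnW lt_k))).
  move: (take k s) (nth true s k) (nth true s k.+1) (drop k.+2 s).
  move=> s1 x y s2 -> <- ne_xy.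
  by have ->: y = ~~ x by [case: x y ne_xy => [] []]; apply: FitsCap.
Qed.

(** Positions on a line that carries the two strands of the event. *)
Variant pos_spec k : nat -> Prop :=
  | PosBelow p of (p < k)%N : pos_spec k p
  | PosLeft : pos_spec k k
  | PosRight : pos_spec k k.+1
  | PosBeyond q : pos_spec k (k + q).+2.

Lemma posP k p : pos_spec k p.
Proof.
case: (ltnP p k) => [|le_kp]; first exact: PosBelow.
have ->: p = (k + (p - k))%N by lia.
case: (p - k)%N => [|[|q]].
- rewrite addn0; exact: PosLeft.
- rewrite addn1; exact: PosRight.
- rewrite !addnS; exact: PosBeyond.
Qed.

(** Positions on the other line of a cup or a cap. *)
Variant pos2_spec k : nat -> Prop :=
  | Pos2Below p of (p < k)%N : pos2_spec k p
  | Pos2Beyond q : pos2_spec k (k + q).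

Lemma pos2P k p : pos2_spec k p.
Proof.
case: (ltnP p k) => [|le_kp]; first exact: Pos2Below.
rewrite -(subnKC le_kp); exact: Pos2Beyond.
Qed.

Lemma pos_simp_beyond k q :
  ((((k + q).+2 < k)%N = false) * (((k + q).+2 == k) = false)
  * (((k + q).+2 == k.+1) = false) * (((k + q).+2 - k)%N = q.+2)
  * (((k + q).+2 - 2)%N = (k + q)%N)
  * ((k + q < k)%N = false) * ((k + q - k)%N = q))%type.
Proof. by do !split; lia. Qed.

Lemma pos_simp_at k :
  (((k.+1 == k) = false) * ((k.+1 < k)%N = false)
  * ((k.+1 - k)%N = 1%N) * ((k - k)%N = 0%N)
  * ((k < k)%N = false) * ((k == k.+1) = false) * ((k == k) = true))%type.
Proof. by do !split; lia. Qed.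

Lemma pos_simp_below k p : (p < k)%N ->
  ((p == k) = false) * ((p == k.+1) = false) * ((p < k)%N = true)
  * ((p <= k)%N = true).
Proof. by move=> lt_pk; do !split; lia. Qed.

Ltac port_simpl :=
  rewrite /= ?pos_simp_at ?pos_simp_beyond /=;
  try match goal with
  | ltp : is_true (_ < size _)%N |- _ => rewrite ?(pos_simp_below ltp) /=
  end;
  rewrite ?size_cat /= ?nth_cat ?pos_simp_at ?pos_simp_beyond /=;
  try match goal with
  | ltp : is_true (_ < size _)%N |- _ => rewrite ?(pos_simp_below ltp) /=
  end.

Ltac port_cases P := case: P => [? ?|||?]; port_simpl.
Ltac port_cases2 P := case: P => [? ?|?]; port_simpl.

(** Each piece of strand has two distinct ends, one of which is where its
    orientation enters the slice and the other where it leaves. *)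
Lemma across_spec g s e : fits g s -> valid_port g s e ->
  [/\ valid_port g s (across g e), across g (across g e) = e
    & inward g s (across g e) = ~~ inward g s e].
Proof.
move/fitsP; rewrite /valid_port /inward /line.
move: (above g s) => s' gs; case: gs e => [b s1 x y s2|o s1 s2|x s1 s2] [[] p].
- by port_cases (posP (size s1) p) => lt_p; split=> //; try lia;
    case: nth; case: x; case: y.
- by port_cases (posP (size s1) p) => lt_p; split=> //; try lia;
    case: nth; case: x; case: y.
- by port_cases (posP (size s1) p) => lt_p; split=> //; try lia; case: nth.
- by port_cases2 (pos2P (size s1) p) => lt_p; split=> //; try lia; case: nth.
- by port_cases2 (pos2P (size s1) p) => lt_p; split=> //; try lia; case: nth.
by port_cases (posP (size s1) p) => lt_p; split=> //; try lia; case: nth.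
Qed.

Definition is_crossing (g : slice) : bool :=
  if g is Crossing _ _ then true else false.

(** The end at which the overcrossing piece enters the crossing; the value on
    other slices is junk. *)
Definition over_entry (g : slice) (s : seq bool) : port :=
  match g with
  | Crossing k b =>
      let e := (false, if b then k else k.+1) in
      if nth true s e.2 then e else across g e
  | _ => (true, 0%N)
  end.

Lemma crossing_spec g s : fits g s -> is_crossing g ->
  [/\ valid_port g s (under_exit g s), ~~ inward g s (under_exit g s),
      valid_port g s (over_entry g s), inward g s (over_entry g s)
    & on_over g (over_entry g s)].
Proof.
move/fitsP; rewrite /valid_port /inward /line.
move: (above g s) => s' gs; case: gs => // [b s1 x y s2] _.
by case: b; port_simpl; case: x; case: y; port_simpl; split;
  rewrite ?eqxx ?orbT //; lia.
Qed.

Lemma across_over_entry g s : fits g s -> is_crossing g ->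
  across g (over_entry g s) != under_exit g s.
Proof.
move/fitsP; move: (above g s) => s' gs; case: gs => // [b s1 x y s2] _.
by case: b; port_simpl; case: x; case: y; port_simpl;
  rewrite // !xpair_eqE; port_simpl.
Qed.

Lemma over_entry_uniq g s e : fits g s -> inward g s e -> on_over g e ->
  is_crossing g /\ e = over_entry g s.
Proof.
move/fitsP; rewrite /inward /line.
move: (above g s) => s' gs; case: gs e => // [b s1 x y s2] e in_e ov_e.
split=> //; move: ov_e in_e.
by case: b => /orP[] /eqP->; port_simpl; case: x; case: y; port_simpl.
Qed.

(** * The conservation law at a slice *)

Section Flux.
Variables (K : fieldType) (t : K).

Definition turn (b : bool) : K := if b then t else t^-1.

(** With the leftmost region numbered 0, this is t to the smaller of the numbers
    of the two regions next to the p-th point: the region on its right is higher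
    than the one on its left if the point is oriented upwards, and lower
    otherwise. *)
Definition flux (s : seq bool) (p : nat) : K :=
  (\prod_(b <- take p s) turn b) * (if nth true s p then 1 else t^-1).

Lemma flux_cat s1 s2 p : flux (s1 ++ s2) p =
  if (p < size s1)%N then flux s1 p
  else (\prod_(b <- s1) turn b) * flux s2 (p - size s1).
Proof.
rewrite /flux take_cat nth_cat; case: ifP => // _.
by rewrite big_cat /= mulrA.
Qed.

Lemma flux_head b s : flux (b :: s) 0 = if b then 1 else t^-1.
Proof. by rewrite /flux /= big_nil mul1r. Qed.

Lemma flux_behead b s p : flux (b :: s) p.+1 = turn b * flux s p.
Proof. by rewrite /flux /= big_cons mulrA. Qed.

Definition port_flux g s (e : port) : K := flux (line g s e.1) e.2.

Definition over_weight g s : K := if positive g s then t else t^-1.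

Ltac flux_simpl :=
  rewrite ?flux_cat ?flux_head ?flux_behead; port_simpl;
  rewrite ?flux_cat ?flux_head ?flux_behead ?xpair_eqE; port_simpl;
  rewrite ?flux_head ?mulr1 ?addr0 /turn /=.

(** Passing a strand does not change the region numbers on its two sides, so
    away from a crossing the flux of an exit is that of the other end.  The two
    exits of a crossing differ in flux by a factor t, as do the two entries;
    with the weights w and 1 - w of the overcrossing strand these factors
    balance, for every sign and every orientation. *)
Lemma flux_balance g s e : t != 0 -> fits g s -> valid_port g s e ->
    ~~ inward g s e ->
  port_flux g s e =
    port_flux g s (across g e) *
      (if on_over g (across g e) then over_weight g s else 1) +
    (if is_crossing g && (e == under_exit g s)
     then port_flux g s (over_entry g s) * (1 - over_weight g s) else 0).
Proof.
move=> t0 /fitsP; rewrite /valid_port /inward /port_flux /line /over_weight.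
move: (above g s) => s' gs.
case: gs e => [b s1 x y s2|o s1 s2|x s1 s2] [[] p].
- case: b; port_cases (posP (size s1) p); case: x; case: y;
    flux_simpl => lt_p dir //; by field.
- case: b; port_cases (posP (size s1) p); case: x; case: y;
    flux_simpl => lt_p dir //; by field.
- port_cases (posP (size s1) p); case: o; flux_simpl => lt_p dir //; by field.
- port_cases2 (pos2P (size s1) p); case: o; flux_simpl => lt_p dir //; by field.
- port_cases2 (pos2P (size s1) p); case: x; flux_simpl => lt_p dir //; by field.
- port_cases (posP (size s1) p); case: x; flux_simpl => lt_p dir //; by field.
Qed.

End Flux.

(** * Points of a diagram and transitions between them *)

Section Diagram.
Variables (n : nat) (D : diagram).
Hypothesis tangleD : tangle_diagram n D.

Local Notation sl l := (slice_at D l).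
Local Notation lev l := (level n D l).
Local Notation pts := (points n D).

Lemma mem_points x :
  (x \in pts) = (x.1 <= size D)%N && (x.2 < size (lev x.1))%N.
Proof.
case: x => l p; apply/allpairsPdep/idP => [[l' [p' []]]|/andP[/= le_l lt_p]].
  rewrite !mem_iota => /andP[_ le_l] /andP[_ lt_p] [-> ->].
  by rewrite -ltnS le_l.
have lP : l \in iota 0 (size D).+1 by rewrite mem_iota.
by exists l, p; split=> //; rewrite mem_iota.
Qed.

Lemma points_uniq : uniq pts.
Proof.
apply: allpairs_uniq_dep; rewrite ?iota_uniq //.
- by move=> l _; apply: iota_uniq.
- by move=> [l p] [l' p'] _ _ /= [-> ->].
Qed.

Lemma level_top : lev (size D) = nseq n true. Proof. by case: tangleD. Qed.

Lemma level_succ l : (l < size D)%N -> lev l.+1 = above (sl l) (lev l).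
Proof.
by move=> lt_l; rewrite /level (take_nth (Cap 0)) // -cats1 foldl_cat.
Qed.

Lemma fits_slice l : (l < size D)%N -> fits (sl l) (lev l).
Proof. by case: tangleD => + _; apply. Qed.

Lemma level_line l (b : bool) : (l < size D)%N ->
  lev (l + b) = line (sl l) (lev l) b.
Proof. by case: b; rewrite ?addn1 ?addn0 // => /level_succ. Qed.

Definition is_entry l e :=
  valid_port (sl l) (lev l) e && inward (sl l) (lev l) e.

Definition is_exit l e :=
  valid_port (sl l) (lev l) e && ~~ inward (sl l) (lev l) e.

Lemma port_point_mem l e : (l < size D)%N -> valid_port (sl l) (lev l) e ->
  port_point l e \in pts.
Proof.
move=> lt_l; rewrite /valid_port mem_points /= (level_line e.1 lt_l) => ->.
by rewrite andbT; case: e.1; rewrite /= ?addn1 ?addn0 // ltnW.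
Qed.

Lemma entryP l e : (l < size D)%N -> is_entry l e ->
  next_slice n D (port_point l e) = l /\ entry n D (port_point l e) = e.
Proof.
move=> lt_l /andP[_]; rewrite /inward /next_slice /entry /upwards /=.
rewrite (level_line e.1 lt_l); case: e => [[] p] /=; case: nth => //= _;
by rewrite ?addn0 ?addn1.
Qed.

Definition prev_slice x : nat := if upwards n D x then x.1.-1 else x.1.

Lemma exitP l e : (l < size D)%N -> is_exit l e ->
  prev_slice (port_point l e) = l
  /\ (upwards n D (port_point l e), e.2) = e.
Proof.
move=> lt_l /andP[_]; rewrite /inward /prev_slice /upwards /=.
rewrite (level_line e.1 lt_l); case: e => [[] p] /=; case: nth => //= _;
by rewrite ?addn0 ?addn1.
Qed.

(** An interior point is a port of two slices, but its orientation makes it an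
    exit of only one of them. *)
Lemma exit_inj l e l' e' : (l < size D)%N -> (l' < size D)%N ->
    is_exit l e -> is_exit l' e' ->
  port_point l e = port_point l' e' -> l = l' /\ e = e'.
Proof.
move=> lt_l lt_l' ex ex' eq_pt.
have [pl pe] := exitP lt_l ex; have [pl' pe'] := exitP lt_l' ex'.
split; first by rewrite -pl -pl' eq_pt.
by rewrite -pe -pe' eq_pt; case: eq_pt => _ ->.
Qed.

Definition at_top (x : lpoint) : bool := x.1 == size D.

(** The bottom and the top line consist of upward points, so the walk cannot
    leave the diagram through the bottom and stops exactly when it is at the
    top. *)
Lemma next_slice_lt x : x \in pts ->
  (next_slice n D x < size D)%N = ~~ at_top x.
Proof.
rewrite mem_points /next_slice /upwards /at_top; case: x => l p /= /andP[le_l].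
case: ifP => [_ _|]; first by rewrite ltn_neqAle le_l andbT.
case: l le_l => [_|l /= le_l]; last first.
  rewrite le_l => up lt_p; case: eqP => // eq_l.
  by move: up lt_p; rewrite eq_l level_top size_nseq nth_nseq; case: ifP.
by rewrite /level take0 /= nth_nseq size_nseq; case: ifP.
Qed.

Lemma entry_next x : x \in pts -> ~~ at_top x ->
  is_entry (next_slice n D x) (entry n D x)
  /\ port_point (next_slice n D x) (entry n D x) = x.
Proof.
move=> xP xt; have := next_slice_lt xP; rewrite xt => lt_x.
have eq_x : port_point (next_slice n D x) (entry n D x) = x.
  move: xP; rewrite mem_points.
  rewrite /port_point /next_slice /entry /upwards; case: x {xt lt_x} => l p /=.
  case: ifP => //=; first by rewrite addn0.
  case: l => [|l]; last by rewrite addn1.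
  by rewrite /level take0 /= nth_nseq size_nseq; case: ifP.
split=> //; rewrite /is_entry /valid_port /inward -(level_line _ lt_x).
have eq1 : (next_slice n D x + (entry n D x).1)%N = x.1.
  by move/(congr1 fst): eq_x.
rewrite eq1 /=; move: xP; rewrite mem_points => /andP[_ ->].
by rewrite /upwards; case: nth.
Qed.

Lemma exit_prev x : x \in pts -> x.1 != 0%N ->
  exists l e, [/\ (l < size D)%N, is_exit l e & port_point l e = x].
Proof.
case: x => l p; rewrite mem_points /= => /andP[le_l lt_p] l0.
have lt_l : (l.-1 < size D)%N by lia.
have eq_l : (l.-1 + true)%N = l by rewrite addn1 prednK // lt0n.
case: (boolP (nth true (lev l) p)) => up.
  exists l.-1, (true, p); split=> //.
    rewrite /is_exit /valid_port /inward -(level_line _ lt_l) eq_l /= lt_p.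
    by rewrite up.
  by rewrite /port_point /= eq_l.
have {}lt_l : (l < size D)%N.
  rewrite ltn_neqAle le_l andbT; apply/eqP => eqD.
  by move: up lt_p; rewrite eqD level_top nth_nseq size_nseq; case: ifP.
exists l, (false, p); split=> //; last by rewrite /port_point /= addn0.
by rewrite /is_exit /valid_port /inward /= lt_p /= negbK (negbTE up).
Qed.

Definition follow_pt x := port_point (next_slice n D x)
  (across (sl (next_slice n D x)) (entry n D x)).

Definition switch_pt x := port_point (next_slice n D x)
  (under_exit (sl (next_slice n D x)) (lev (next_slice n D x))).

Lemma followsE x y : x \in pts ->
  follows n D x y = ~~ at_top x && (y == follow_pt x).
Proof. by move=> xP; rewrite /follows next_slice_lt. Qed.

Lemma switchesE x y :
  switches n D x y = overcrosses n D x && (y == switch_pt x).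
Proof. by []. Qed.

Lemma is_crossing_over g e : on_over g e -> is_crossing g.
Proof. by case: g. Qed.

Lemma overcrosses_at_top x : x \in pts -> overcrosses n D x -> ~~ at_top x.
Proof. by move=> xP /andP[]; rewrite next_slice_lt. Qed.

Lemma under_exit_is_exit l : (l < size D)%N -> is_crossing (sl l) ->
  is_exit l (under_exit (sl l) (lev l)).
Proof.
move=> lt_l cr; rewrite /is_exit.
by have [-> ->] := crossing_spec (fits_slice lt_l) cr.
Qed.

Lemma over_entry_is_entry l : (l < size D)%N -> is_crossing (sl l) ->
  is_entry l (over_entry (sl l) (lev l)).
Proof.
move=> lt_l cr; rewrite /is_entry.
by have [_ _ -> ->] := crossing_spec (fits_slice lt_l) cr.
Qed.

Lemma across_entry l e : (l < size D)%N -> is_entry l e ->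
  is_exit l (across (sl l) e).
Proof.
move=> lt_l /andP[vP inP]; have [v _ i] := across_spec (fits_slice lt_l) vP.
by rewrite /is_exit v i inP.
Qed.

Lemma across_exit l e : (l < size D)%N -> is_exit l e ->
  is_entry l (across (sl l) e).
Proof.
move=> lt_l /andP[vP inP]; have [v _ i] := across_spec (fits_slice lt_l) vP.
by rewrite /is_entry v i inP.
Qed.

Lemma follow_pt_mem x : x \in pts -> ~~ at_top x -> follow_pt x \in pts.
Proof.
move=> xP xt; have lt_l := next_slice_lt xP; rewrite xt in lt_l.
have [en _] := entry_next xP xt.
by have /andP[vP _] := across_entry lt_l en; apply: port_point_mem.
Qed.

Lemma switch_pt_mem x : x \in pts -> overcrosses n D x -> switch_pt x \in pts.
Proof.
move=> xP /andP[lt_l ov].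
have /andP[vP _] := under_exit_is_exit lt_l (is_crossing_over ov).
exact: port_point_mem.
Qed.

Lemma follow_switch_neq x : x \in pts -> overcrosses n D x ->
  follow_pt x != switch_pt x.
Proof.
move=> xP ov; have xt := overcrosses_at_top xP ov.
have /andP[lt_l o] := ov; have [en _] := entry_next xP xt.
have cr := is_crossing_over o.
have ue := under_exit_is_exit lt_l cr.
apply/eqP => /(exit_inj lt_l lt_l (across_entry lt_l en) ue).
case=> _; have /andP[_ inE] := en.
have [_ eqe] := over_entry_uniq (fits_slice lt_l) inE o.
by rewrite {1}eqe; apply/eqP; apply: across_over_entry => //; apply: fits_slice.
Qed.

(** Since a step is of one kind only, the weights of the two kinds can be added
    to give the weight of a step. *)
Lemma switch_not_follow x y : x \in pts -> switches n D x y ->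
  ~~ follows n D x y.
Proof.
move=> xP; rewrite switchesE => /andP[ov /eqP->].
by rewrite followsE // eq_sym (negbTE (follow_switch_neq _ _)) ?andbF.
Qed.

Lemma admissible_mem x y : x \in pts -> admissible_step n D x y -> y \in pts.
Proof.
move=> xP /orP[].
  by rewrite followsE // => /andP[xt /eqP->]; apply: follow_pt_mem.
by rewrite switchesE => /andP[ov /eqP->]; apply: switch_pt_mem.
Qed.

Lemma exit_above_bottom l e : (l < size D)%N -> is_exit l e ->
  (port_point l e).1 != 0%N.
Proof.
case: e => [[] p] lt_l; rewrite /= ?addn1 // addn0; case: l lt_l => // _.
rewrite /is_exit /valid_port /inward /= /level take0 /= nth_nseq size_nseq.
by case: ifP.
Qed.

Lemma follows_exit l e x : (l < size D)%N -> is_exit l e -> x \in pts ->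
  follows n D x (port_point l e) = (x == port_point l (across (sl l) e)).
Proof.
move=> lt_l ex xP; have /andP[eV eI] := ex.
have [_ aK _] := across_spec (fits_slice lt_l) eV.
apply/idP/eqP => [|->].
  rewrite followsE // => /andP[xt /eqP].
  have := next_slice_lt xP; rewrite xt => lt_x.
  have [en eq_x] := entry_next xP xt; have /andP[enV _] := en.
  move/(exit_inj lt_l lt_x ex (across_entry lt_x en)) => [eq_l eq_e].
  rewrite -{1}eq_x eq_l eq_e.
  by have [_ -> _] := across_spec (fits_slice lt_x) enV.
rewrite /follows; have [-> ->] := entryP lt_l (across_exit lt_l ex).
by rewrite lt_l aK eqxx.
Qed.

Lemma switches_exit l e x : (l < size D)%N -> is_exit l e -> x \in pts ->
  switches n D x (port_point l e) =
    (is_crossing (sl l) && (e == under_exit (sl l) (lev l))) &&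
    (x == port_point l (over_entry (sl l) (lev l))).
Proof.
move=> lt_l ex xP; apply/idP/idP.
  rewrite switchesE => /andP[ov /eqP]; have xt := overcrosses_at_top xP ov.
  have /andP[lt_x o] := ov; have cr := is_crossing_over o.
  move/(exit_inj lt_l lt_x ex (under_exit_is_exit lt_x cr)) => [eq_l ->].
  have [en eq_x] := entry_next xP xt; have /andP[_ enI] := en.
  rewrite eq_l cr eqxx /=.
  by have [_ <-] := over_entry_uniq (fits_slice lt_x) enI o; rewrite eq_x.
case/andP => /andP[cr /eqP->] /eqP->.
have oe := over_entry_is_entry lt_l cr.
have [_ _ _ _ o] := crossing_spec (fits_slice lt_l) cr.
rewrite /switches /overcrosses; have [-> ->] := entryP lt_l oe.
by rewrite lt_l o eqxx.
Qed.

Section Weights.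
Variables (K : fieldType) (t : K).

Lemma sum_steps (a b : K) (phi : lpoint -> K) x : x \in pts ->
  \sum_(y <- pts) ((if follows n D x y then a else 0)
                   + (if switches n D x y then b else 0)) * phi y =
  (if at_top x then 0 else a * phi (follow_pt x))
  + (if overcrosses n D x then b * phi (switch_pt x) else 0).
Proof.
move=> xP; under eq_bigr do rewrite mulrDl.
rewrite big_split /=; congr (_ + _).
  under eq_bigr do rewrite followsE //.
  case: (boolP (at_top x)) => [_|xt] /=.
    by rewrite big1 // => y _; rewrite mul0r.
  rewrite -(sum_delta (fun y => a * phi y) points_uniq (follow_pt_mem xP xt)).
  by apply: eq_bigr => y _; case: ifP => // _; rewrite mul0r.
under eq_bigr do rewrite switchesE.
case: (boolP (overcrosses n D x)) => [ov|_] /=; last first.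
  by rewrite big1 // => y _; rewrite mul0r.
rewrite -(sum_delta (fun y => b * phi y) points_uniq (switch_pt_mem xP ov)).
by apply: eq_bigr => y _; case: ifP => // _; rewrite mul0r.
Qed.

Definition crossing_weight x : K :=
  over_weight t (sl (next_slice n D x)) (lev (next_slice n D x)).

Definition transition x y : K :=
  (if follows n D x y then if overcrosses n D x then crossing_weight x else 1
   else 0)
  + (if switches n D x y then 1 - crossing_weight x else 0).

Lemma transition_row x : x \in pts ->
  \sum_(y <- pts) transition x y = if at_top x then 0 else 1.
Proof.
move=> xP; under eq_bigr do rewrite -[transition _ _]mulr1.
rewrite (sum_steps _ _ (fun=> 1) xP) !mulr1.
case: (boolP (at_top x)) => xt.
  by case: ifP => [/(overcrosses_at_top xP)|]; rewrite ?xt ?add0r.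
by case: ifP; rewrite ?addr0 // addrC subrK.
Qed.

Definition point_flux x : K := flux t (lev x.1) x.2.

(** Every point above the bottom line is an exit of exactly one slice, and the
    transitions into it come from that slice. *)
Lemma transition_col y : t != 0 -> y \in pts ->
  \sum_(x <- pts) point_flux x * transition x y =
    if y.1 == 0%N then 0 else point_flux y.
Proof.
move=> t0 yP; case: (boolP (y.1 == 0%N)) => [/eqP y0|y0].
  rewrite big_seq big1 // => x xP.
  suff: ~~ admissible_step n D x y.
    rewrite /admissible_step /transition negb_or => /andP[/negbTE-> /negbTE->].
    by rewrite addr0 mulr0.
  apply/negP => /orP[] /andP[].
    move=> lt_l /eqP eq_y; have xt : ~~ at_top x by rewrite -(next_slice_lt xP).
    have [en _] := entry_next xP xt.
    by have := exit_above_bottom lt_l (across_entry lt_l en); rewrite -eq_y y0.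
  move=> ov /eqP eq_y; have /andP[lt_l o] := ov.
  have ue := under_exit_is_exit lt_l (is_crossing_over o).
  by have := exit_above_bottom lt_l ue; rewrite -eq_y y0.
have [l [e [lt_l ex <-]]] := exit_prev yP y0.
have fl e' : point_flux (port_point l e') = port_flux t (sl l) (lev l) e'.
  by rewrite /point_flux /port_flux /= (level_line _ lt_l).
have /andP[eV eI] := ex.
rewrite (fl e) (flux_balance t0 (fits_slice lt_l) eV) //.
rewrite big_seq; under eq_bigr => x xP.
  rewrite /transition follows_exit // switches_exit // mulrDr.
  over.
rewrite -big_seq big_split /=; congr (_ + _).
  set a := port_point _ _.
  have aP : a \in pts.
    by have /andP[vP _] := across_exit lt_l ex; apply: port_point_mem.
  rewrite -fl -/a.
  have -> : on_over (sl l) (across (sl l) e) = overcrosses n D a.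
    rewrite /overcrosses; have [-> ->] := entryP lt_l (across_exit lt_l ex).
    by rewrite lt_l.
  have -> : over_weight t (sl l) (lev l) = crossing_weight a.
    rewrite /crossing_weight.
    by have [-> _] := entryP lt_l (across_exit lt_l ex).
  pose F x := point_flux x *
    (if overcrosses n D x then crossing_weight x else 1).
  rewrite -[RHS]/(F a) -(sum_delta F points_uniq aP); apply: eq_bigr => x _.
  by case: ifP; rewrite ?mulr0.
case: ifP => [/andP[cr _]|_] /=; last by rewrite big1 // => x _; rewrite mulr0.
set a := port_point _ _.
have oe := over_entry_is_entry lt_l cr.
have aP : a \in pts by have /andP[vP _] := oe; apply: port_point_mem.
rewrite -fl -/a.
have -> : over_weight t (sl l) (lev l) = crossing_weight a.
  by rewrite /crossing_weight; have [-> _] := entryP lt_l oe.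
pose F x := point_flux x * (1 - crossing_weight x).
rewrite -[RHS]/(F a) -(sum_delta F points_uniq aP); apply: eq_bigr => x _.
by case: ifP; rewrite ?mulr0.
Qed.

End Weights.

End Diagram.

(** * The Green matrix *)

Section Resolvent.
Variables (n : nat) (D : diagram).
Hypothesis tangleD : tangle_diagram n D.
Local Notation lev l := (level n D l).
Local Notation pts := (points n D).
Local Notation N := (size pts).

Definition pt (k : 'I_N) : lpoint := tnth (in_tuple pts) k.

Lemma pt_mem k : pt k \in pts. Proof. exact: mem_tnth. Qed.

Lemma pt_inj : injective pt.
Proof.
move=> k m eq_km; apply/val_inj/eqP.
rewrite -(nth_uniq (0%N, 0%N) (ltn_ord k) (ltn_ord m) (points_uniq n D)).
by move: eq_km; rewrite /pt !(tnth_nth (0%N, 0%N)) => ->.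
Qed.

Lemma sum_pt (V : nmodType) (F : lpoint -> V) :
  \sum_k F (pt k) = \sum_(x <- pts) F x.
Proof. by rewrite [RHS]big_tnth. Qed.

Definition unit_row (R : pzRingType) (x : lpoint) : 'rV[R]_N :=
  \row_k (pt k == x)%:R.

Lemma sum_unit (R : pzRingType) (F : lpoint -> R) x : x \in pts ->
  \sum_k F (pt k) * (pt k == x)%:R = F x.
Proof.
move=> xP; rewrite (sum_pt (fun y => F y * (y == x)%:R)).
rewrite -[RHS](sum_delta F (points_uniq n D) xP).
by apply: eq_bigr => y _; case: eqP => _; rewrite ?mulr1 ?mulr0.
Qed.

Section Green.
Variables (K : fieldType) (t : K).

Definition transition_mx : 'M[K]_N :=
  \matrix_(k, m) transition n D t (pt k) (pt m).

Variable G : 'M[K]_N.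

(** The Green function: the entry of [G] with row x and column y. *)
Definition green (x y : lpoint) : K :=
  (unit_row K x *m G *m (unit_row K y)^T) 0 0.

Hypothesis t0 : t != 0.
Hypothesis GK : G *m (1%:M - transition_mx) = 1%:M.

Let KG : (1%:M - transition_mx) *m G = 1%:M.
Proof. exact: mulmx1C. Qed.

Lemma top_mem (j : 'I_n) : (size D, val j) \in pts.
Proof. by rewrite mem_points leqnn (level_top tangleD) size_nseq /=. Qed.

Lemma bottom_mem (i : 'I_n) : (0%N, val i) \in pts.
Proof. by rewrite mem_points /= /level take0 /= size_nseq. Qed.

(** The constant vector is mapped by 1 - A to the indicator of the top line. *)
Lemma green_top x : x \in pts -> \sum_(j < n) green x (size D, val j) = 1.
Proof.
move=> xP; pose one : 'cV[K]_N := const_mx 1.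
have topE : \sum_(j < n) (unit_row K (size D, val j))^T
             = (1%:M - transition_mx) *m one.
  apply/matrixP => k i; rewrite mulmxBl mul1mx !mxE summxE.
  rewrite (eq_bigr (fun m => transition n D t (pt k) (pt m))); last first.
    by move=> m _; rewrite !mxE mulr1.
  rewrite (sum_pt (transition n D t (pt k))).
  rewrite (transition_row tangleD) ?pt_mem //.
  under eq_bigr do rewrite !mxE.
  have := pt_mem k; rewrite mem_points /at_top; case: (pt k) => l p /= /andP[_].
  case: eqP => [->|neq] lt_p; last first.
    rewrite subrr big1 // => j _; by case: eqP => // -[eq_l _]; case: neq.
  move: lt_p; rewrite (level_top tangleD) size_nseq => lt_p.
  rewrite subr0 (bigD1 (Ordinal lt_p)) //= eqxx big1 ?addr0 // => j ne_j.
  case: eqP => // -[eq_p]; case/eqP: ne_j; exact: val_inj.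
rewrite /green -summxE -mulmx_sumr topE mulmxA -(mulmxA _ G) GK mulmx1.
rewrite mxE (eq_bigr (fun k => 1 * (pt k == x)%:R)); last first.
  by move=> k _; rewrite !mxE mulrC.
exact: (sum_unit (fun=> 1)).
Qed.

Lemma point_flux_upwards l i : lev l = nseq n true -> (i < n)%N ->
  point_flux n D t (l, i) = t ^+ i.
Proof.
move=> lev_l lt_i; rewrite /point_flux /flux /= lev_l nth_nseq lt_i mulr1.
by rewrite take_nseq ?(ltnW lt_i) // big_nseq iter_mulr mulr1.
Qed.

(** The row vector of fluxes is mapped by 1 - A to its restriction to the bottom
    line. *)
Lemma green_bottom (j : 'I_n) :
  \sum_(i < n) green (0%N, val i) (size D, val j) * t ^+ i = t ^+ j.
Proof.
pose F : 'rV[K]_N := \row_k point_flux n D t (pt k).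
have botE : \sum_(i < n) t ^+ i *: unit_row K (0%N, val i)
             = F *m (1%:M - transition_mx).
  apply/matrixP => i k; rewrite mulmxBr mulmx1 !mxE summxE.
  pose f x := point_flux n D t x * transition n D t x (pt k).
  rewrite (eq_bigr (fun m => f (pt m))); last by move=> m _; rewrite !mxE.
  rewrite (sum_pt f) /f transition_col ?pt_mem //.
  under eq_bigr do rewrite !mxE.
  have := pt_mem k; rewrite mem_points; case: (pt k) => l p /= /andP[_].
  case: eqP => [->|neq] lt_p; last first.
    rewrite subrr big1 // => m _.
    case: eqP => [[eq_l _]|_]; [by case: neq | exact: mulr0].
  move: lt_p; rewrite {1}/level take0 /= size_nseq => lt_p.
  rewrite subr0 (bigD1 (Ordinal lt_p)) //= eqxx mulr1 big1 ?addr0.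
    by rewrite point_flux_upwards // /level take0.
  move=> m ne_m; case: eqP => [[eq_p]|_]; last exact: mulr0.
  case/eqP: ne_m; exact: val_inj.
rewrite /green (eq_bigr (fun i : 'I_n => (t ^+ i *: unit_row K (0%N, val i)
                          *m G *m (unit_row K (size D, val j))^T) 0 0));
  last by move=> i _; rewrite -!scalemxAl [in RHS]mxE mulrC.
rewrite -summxE -!mulmx_suml botE -(mulmxA F) KG mulmx1.
rewrite mxE (eq_bigr (fun k => point_flux n D t (pt k)
                               * (pt k == (size D, val j))%:R)); last first.
  by move=> k _; rewrite !mxE.
rewrite (sum_unit (point_flux n D t)) ?top_mem //.
exact: point_flux_upwards (level_top tangleD) (ltn_ord j).
Qed.

Lemma greenE x z : x \in pts ->
  green x z = (x == z)%:R + \sum_(y <- pts) transition n D t x y * green y z.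
Proof.
move=> xP; have GE : G = 1%:M + transition_mx *m G.
  by apply/eqP; rewrite -subr_eq; apply/eqP; rewrite -KG mulmxBl mul1mx.
rewrite {1}/green {1}GE mulmxDr mulmx1 mulmxDl mxE; congr (_ + _).
  pose f y : K := (y == z)%:R.
  rewrite mxE (eq_bigr (fun k => f (pt k) * (pt k == x)%:R)).
    exact: sum_unit.
  by move=> k _; rewrite !mxE mulrC.
have -> : unit_row K x *m (transition_mx *m G) =
   \sum_k transition n D t x (pt k) *: (unit_row K (pt k) *m G).
  rewrite mulmxA; under eq_bigr do rewrite scalemxAl.
  rewrite -mulmx_suml; congr (_ *m _); apply/matrixP => i m.
  rewrite !mxE summxE.
  pose f y := transition n D t y (pt m).
  rewrite (eq_bigr (fun k => f (pt k) * (pt k == x)%:R)); last first.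
    by move=> k _; rewrite !mxE mulrC.
  rewrite sum_unit // /f (bigD1 m) //= !mxE eqxx mulr1 big1 ?addr0 // => k ne_k.
  by rewrite !mxE (inj_eq pt_inj) eq_sym (negbTE ne_k) mulr0.
rewrite mulmx_suml summxE.
rewrite (eq_bigr (fun k => transition n D t x (pt k) * green (pt k) z)).
  exact: (sum_pt (fun y => transition n D t x y * green y z)).
by move=> k _; rewrite -scalemxAl [LHS]mxE.
Qed.

End Green.

(** * Rationality of the Green matrix *)

(** The transition weights are Laurent polynomials in t; multiplied by the
    indeterminate they become polynomials. *)
Definition poly_weight x : {poly rat} :=
  if positive (slice_at D (next_slice n D x)) (lev (next_slice n D x))
  then 'X ^+ 2 else 1.

Definition poly_transition x y : {poly rat} :=
  (if follows n D x y then if overcrosses n D x then poly_weight x else 'X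
   else 0)
  + (if switches n D x y then 'X - poly_weight x else 0).

Definition poly_mx : 'M[{poly rat}]_N :=
  \matrix_(k, m) ((k == m)%:R * 'X - poly_transition (pt k) (pt m)).

Definition green_den : {poly rat} := \det poly_mx.

(** By Cramer's rule the inverse of [poly_mx] is its adjugate divided by its
    determinant; the factor ['X] undoes the multiplication by the
    indeterminate. *)
Definition green_num (x y : lpoint) : {poly rat} :=
  'X * (unit_row _ x *m \adj poly_mx *m (unit_row _ y)^T) 0 0.

Section Specialize.
Variables (K : fieldType) (phi : {rmorphism {poly rat} -> K}).
Local Notation t := (phi 'X).
Hypothesis t0 : t != 0.

Lemma map_poly_mx : map_mx phi poly_mx = t *: (1%:M - transition_mx t).
Proof.
have wE x : phi (poly_weight x) = t * crossing_weight n D t x.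
  rewrite /poly_weight /crossing_weight /over_weight.
  by case: ifP => _; rewrite ?rmorphXn ?expr2 // rmorph1 divff.
apply/matrixP => k m; rewrite !mxE rmorphB rmorphM rmorph_nat mulrBr mulrC.
congr (_ - _); rewrite /poly_transition /transition rmorphD mulrDr.
by congr (_ + _); do ?case: ifP => _;
  rewrite ?rmorphB ?wE ?rmorph0 ?mulr0 ?mulr1 ?mulrBr ?mulr1.
Qed.

Definition green_mx : 'M[K]_N :=
  (t / phi green_den) *: map_mx phi (\adj poly_mx).

Lemma map_unit_row x : map_mx phi (unit_row _ x) = unit_row K x.
Proof. by apply/matrixP => i k; rewrite !mxE rmorph_nat. Qed.

Lemma green_mxK : phi green_den != 0 ->
  green_mx *m (1%:M - transition_mx t) = 1%:M.
Proof.
move=> q0; have := congr1 (map_mx phi) (mul_adj_mx poly_mx).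
rewrite map_mxM map_scalar_mx map_poly_mx -scalemxAr => adjK.
rewrite /green_mx -scalemxAl mulrC -scalerA adjK scale_scalar_mx.
by rewrite mulVf.
Qed.

Lemma green_ratio x y :
  phi (green_num x y) / phi green_den = green green_mx x y.
Proof.
rewrite /green /green_num /green_mx rmorphM -!scalemxAr -scalemxAl [RHS]mxE.
rewrite mulrAC; congr (_ * _).
by rewrite -!map_unit_row map_trmx -!map_mxM [RHS]mxE.
Qed.

End Specialize.
End Resolvent.

(** * Unconditional convergence of the path sums *)

#[local] Existing Instance totally_filter.

Lemma geometric_tail (R : realFieldType) m j :
  \sum_(k <- iota m j) (3 / 4 : R) ^+ k <= 4 * (3 / 4) ^+ m.
Proof.
elim: j m => [|j IH] m; first by rewrite big_nil mulr_ge0 ?exprn_ge0 //; lra.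
rewrite /= big_cons; apply: le_trans (lerD (lexx _) (IH _)) _.
by rewrite exprS; lra.
Qed.

Section Walks.
Variables (R : realType) (n : nat) (D : diagram) (t : R).
Hypothesis tangleD : tangle_diagram n D.
Local Notation pts := (points n D).
Local Notation step := (admissible_step n D).

Fixpoint walks (m : nat) (x : lpoint) : seq (seq lpoint) :=
  if m is m'.+1 then
    [seq y :: P | y <- [seq y <- pts | step x y], P <- walks m' y]
  else [:: [::]].

Lemma walks_uniq m x : uniq (walks m x).
Proof.
elim: m x => [|m IH] x //=; apply: allpairs_uniq_dep.
- exact/filter_uniq/points_uniq.
- by move=> y _; apply: IH.
- by move=> [y P] [y' P'] _ _ /= [-> ->].
Qed.

Lemma mem_walks m x P : x \in pts ->
  (P \in walks m x) = (size P == m) && path step x P.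
Proof.
elim: m x P => [|m IH] x P xP.
  by rewrite /= inE; case: P.
case: P => [|y P] /=; first by apply/allpairsPdep => -[y [P [_ _]]].
rewrite eqSS; apply/allpairsPdep/idP => [[y' [P' [+ + [-> ->]]]]|].
  by rewrite mem_filter => /andP[-> yP]; rewrite IH.
case/and3P=> sP xy pP; have yP := admissible_mem tangleD xP xy.
by exists y, P; rewrite mem_filter xy yP IH // sP.
Qed.

Definition walk_weight (x : lpoint) (P : seq lpoint) : R :=
  \prod_(e <- zip (x :: P) P) step_weight n D t e.1 e.2.

Lemma walk_weight_cons x y P :
  walk_weight x (y :: P) = step_weight n D t x y * walk_weight y P.
Proof. by rewrite /walk_weight /= big_cons. Qed.

Lemma transitionE x y : x \in pts ->
  transition n D t x y = if step x y then step_weight n D t x y else 0.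
Proof.
move=> xP; rewrite /transition /step_weight /admissible_step.
rewrite -/(over_weight t _ _) -/(crossing_weight _ _ _ _).
case: (boolP (switches n D x y)) => [sw|_].
  rewrite (negbTE (switch_not_follow tangleD xP sw)) add0r.
  by move: sw; rewrite switchesE => /andP[-> _].
by rewrite addr0 orbF; case: ifP.
Qed.

(** The transition matrix acting on functions of the points. *)
Definition avg (phi : lpoint -> R) (x : lpoint) : R :=
  \sum_(y <- pts) transition n D t x y * phi y.

Lemma big_walksS m x (F : seq lpoint -> R) :
  \sum_(P <- walks m.+1 x) F P =
  \sum_(y <- pts) (if step x y then \sum_(P <- walks m y) F (y :: P) else 0).
Proof. by rewrite big_allpairs_dep big_filter big_mkcond. Qed.

Lemma walk_sum m phi x : x \in pts ->
  \sum_(P <- walks m x) walk_weight x P * phi (last x P) = iter m avg phi x.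
Proof.
elim: m x => [|m IH] x xP.
  by rewrite big_seq1 /walk_weight big_nil mul1r.
rewrite big_walksS iterS /avg big_seq [RHS]big_seq; apply: eq_bigr => y yP.
rewrite transitionE //; case: ifP => _; last by rewrite mul0r.
rewrite -IH // mulr_sumr; apply: eq_bigr => P _.
by rewrite walk_weight_cons mulrA.
Qed.

Variable h : lpoint -> R.
Hypothesis h_ge1 : forall x, x \in pts -> 1 <= h x.
Hypothesis h_contr : forall x, x \in pts ->
  \sum_(y <- pts) `|transition n D t x y| * h y <= 3 / 4 * h x.

Lemma walk_abs m x : x \in pts ->
  \sum_(P <- walks m x) `|walk_weight x P| <= (3 / 4) ^+ m * h x.
Proof.
elim: m x => [|m IH] x xP.
  by rewrite big_seq1 /walk_weight big_nil normr1 expr0 mul1r h_ge1.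
rewrite big_walksS exprSr -mulrA.
apply: le_trans (ler_wpM2l _ (h_contr xP)); last by apply: exprn_ge0; lra.
rewrite mulr_sumr big_seq [leRHS]big_seq; apply: ler_sum => y yP.
rewrite transitionE //; case: ifP => _; last by rewrite normr0 mul0r mulr0.
under eq_bigr do rewrite walk_weight_cons normrM.
rewrite -mulr_sumr mulrCA; apply: ler_wpM2l => //; exact: IH.
Qed.

Lemma iter_avg_bound (phi : lpoint -> R) c m x :
    (forall y, y \in pts -> `|phi y| <= c * h y) -> x \in pts ->
  `|iter m avg phi x| <= (3 / 4) ^+ m * (c * h x).
Proof.
move=> phi_le; elim: m x => [|m IH] x xP; first by rewrite mul1r phi_le.
have c0 : 0 <= c.
  have := le_trans (normr_ge0 _) (phi_le _ xP); have := h_ge1 xP => h1.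
  by rewrite pmulr_lge0 // (lt_le_trans ltr01).
rewrite iterS /avg; apply: le_trans (ler_norm_sum _ _ _) _.
have a0 : 0 <= (3 / 4 : R) ^+ m * c by rewrite mulr_ge0 // exprn_ge0 //; lra.
have := ler_wpM2l a0 (h_contr xP).
rewrite (_ : _ * (3 / 4 * h x) = (3 / 4) ^+ m.+1 * (c * h x)); last first.
  by rewrite exprS; ring.
apply: le_trans; rewrite mulr_sumr big_seq [leRHS]big_seq.
apply: ler_sum => y yP; rewrite normrM.
rewrite mulrCA; apply: ler_wpM2l => //; rewrite -mulrA; exact: IH.
Qed.

(** Iterating g = delta + A g gives g as a partial Neumann sum of delta, up to a
    remainder that [iter_avg_bound] makes small. *)
Lemma renewal (g delta : lpoint -> R) m x :
    (forall y, y \in pts -> g y = delta y + avg g y) -> x \in pts ->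
  g x = \sum_(k < m) iter k avg delta x + iter m avg g x.
Proof.
move=> gE; elim: m x => [|m IH] x xP; first by rewrite big_ord0 add0r.
rewrite gE // big_ord_recl -addrA; congr (_ + _).
rewrite iterS {1}/avg; under [in RHS]eq_bigr do rewrite iterS /avg.
rewrite exchange_big /= -big_split /= big_seq [RHS]big_seq.
apply: eq_bigr => y yP.
by rewrite -mulr_sumr -mulrDr -IH.
Qed.

Definition short_walks (m j : nat) x := [seq P | k <- iota m j, P <- walks k x].

Lemma short_walks_uniq m j x : x \in pts -> uniq (short_walks m j x).
Proof.
move=> xP; apply: allpairs_uniq_dep.
- exact: iota_uniq.
- by move=> k _; apply: walks_uniq.
move=> [k P] [k' P'] /allpairsPdep[k1 [P1 [_ + [-> ->]]]].
move=> /[swap] /allpairsPdep[k2 [P2 [_ + [-> ->]]]] /=.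
rewrite !mem_walks // => /andP[/eqP<- _] /andP[/eqP<- _] <-.
by [].
Qed.

Lemma mem_short_walks m j x P : x \in pts ->
  (P \in short_walks m j x) = (m <= size P < m + j)%N && path step x P.
Proof.
move=> xP; apply/allpairsPdep/idP => [[k [P' [+ + ->]]]|/andP[sP pP]].
  by rewrite mem_iota mem_walks // => kP /andP[/eqP-> ->]; rewrite kP.
by exists (size P), P; rewrite mem_iota mem_walks // sP eqxx.
Qed.

Lemma walk_tail m j x : x \in pts ->
  \sum_(P <- short_walks m j x) `|walk_weight x P| <= (3 / 4) ^+ m * (4 * h x).
Proof.
move=> xP; rewrite big_allpairs_dep /=.
apply: le_trans (ler_sum _ (fun k _ => walk_abs k xP)) _.
rewrite -mulr_suml (_ : _ * (4 * _) = 4 * (3 / 4) ^+ m * h x); last by ring.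
by apply: ler_wpM2r (geometric_tail _ _ _); apply: le_trans (h_ge1 xP).
Qed.

(** A finite set of paths that contains all paths of length less than m differs
    from that set only by longer paths, whose total absolute weight is at most
    the tail of a geometric series. *)
Lemma path_sum_green (g : lpoint -> R) x z : x \in pts ->
    (forall y, y \in pts -> g y = (y == z)%:R + avg g y) ->
  (partial_sum (fun P : seq lpoint =>
     if path step x P && (last x P == z) then walk_weight x P else 0)
   @ totally --> g x)%classic.
Proof.
move=> xP gE; set f := fun P => _.
pose c := \sum_(y <- pts) `|g y|.
have c0 : 0 <= c by apply: sumr_ge0.
have g_le y : y \in pts -> `|g y| <= c * h y.
  move=> yP; apply: le_trans (ler_peMr c0 (h_ge1 yP)).
  by rewrite /c (bigD1_seq y) ?points_uniq //= lerDl sumr_ge0.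
have h0 : 0 <= h x by apply: le_trans (h_ge1 xP).
have key m (B : {fset seq lpoint}) :
    {subset short_walks 0 m x <= B} ->
    `|g x - partial_sum f B| <= (3 / 4) ^+ m * (c * h x + 4 * h x).
  move=> sub; rewrite /partial_sum -(big_seq_fsetE _ B xpredT f).
  have fB : \sum_(P <- B) f P =
     \sum_(P <- short_walks 0 m x) f P
     + \sum_(P <- [seq P <- B | (m <= size P)%N && path step x P]) f P.
    rewrite (bigID (fun P => (size P < m)%N && path step x P)) /=.
    congr (_ + _).
      rewrite -big_filter; apply: perm_big; apply: uniq_perm.
      - exact/filter_uniq/fset_uniq.
      - exact: short_walks_uniq.
      move=> P; rewrite mem_filter mem_short_walks //= add0n.
      case: (boolP ((size P < m)%N && path step x P)) => //= wP; apply: sub.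
      by rewrite mem_short_walks.
    rewrite big_filter [LHS]big_mkcond [RHS]big_mkcond; apply: eq_bigr => P _.
    rewrite /f; case: (path step x P) => /=;
      rewrite ?andbT ?andbF /= ?if_same //.
    by rewrite -leqNgt.
  have sum_short : \sum_(P <- short_walks 0 m x) f P
      = \sum_(k < m) iter k avg (fun y => (y == z)%:R) x.
    rewrite big_allpairs_dep /= -[in LHS](subn0 m) big_mkord.
    apply: eq_bigr => k _; rewrite -walk_sum // big_seq [RHS]big_seq.
    apply: eq_bigr => P; rewrite mem_walks // => /andP[_ pP].
    by rewrite /f pP /=; case: eqP; rewrite ?mulr1 ?mulr0.
  rewrite fB sum_short {1}(renewal m gE xP) opprD addrACA subrr add0r.
  apply: le_trans (ler_normB _ _) _; rewrite mulrDr; apply: lerD.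
    exact: iter_avg_bound.
  apply: le_trans (ler_norm_sum _ _ _) _.
  (* The members of B have length less than M. *)
  pose M := \max_(P <- B) (size P).+1.
  apply: le_trans (walk_tail m (M - m) xP).
  apply: (@le_trans _ _ (\sum_(P <- [seq P <- B | (m <= size P)%N
                                          && path step x P])
                           `|walk_weight x P|)).
    by apply: ler_sum => P _; rewrite /f; case: ifP; rewrite // normr0.
  apply: ler_sum_subset => //.
  - exact/filter_uniq/fset_uniq.
  - exact: short_walks_uniq.
  move=> P; rewrite mem_filter mem_short_walks // => /andP[/andP[le_m ->] PB].
  have lt_M : (size P < M)%N by rewrite /M (big_rem P) //= leq_maxl.
  by rewrite le_m andbT subnKC // (leq_trans le_m) // ltnW.
apply/cvgrPdist_le => e e0.
have [m lem] : exists m : nat, (3 / 4) ^+ m * (c * h x + 4 * h x) <= e.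
  have : ((3 / 4 : R) ^+ m * (c * h x + 4 * h x) @[m --> \oo]
           --> 0 * (c * h x + 4 * h x))%classic.
    by apply: cvgM (cvg_cst _); apply: cvg_expr; rewrite ger0_norm; lra.
  rewrite mul0r => /cvgrPdist_le/(_ e e0)[m _ /(_ m (leqnn m))] /= le_m.
  exists m; apply: le_trans le_m; rewrite sub0r normrN; exact: ler_norm.
exists [fset P in short_walks 0 m x]%fset => // B /= /fsubsetP sub.
apply: le_trans lem; apply: key => P PW; apply: sub.
by rewrite inE.
Qed.

End Walks.

(** * Contraction for parameters near 1 *)

Section Contraction.
Variables (R : realType) (n : nat) (D : diagram).
Hypothesis linkD : string_link n D.
Let tangleD : tangle_diagram n D. Proof. by case: linkD. Qed.
Local Notation pts := (points n D).

Lemma follows_reach_top x p y : path (follows n D) x p ->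
  at_top D (last x p) -> y \in x :: p ->
  exists m, at_top D (iter m (follow_pt n D) y).
Proof.
have from_start a q : path (follows n D) a q -> at_top D (last a q) ->
    exists m, at_top D (iter m (follow_pt n D) a).
  elim: q a => [|b q IH] a /=; first by exists 0%N.
  case/andP=> /andP[_ /eqP eq_b] bq topq; have [m] := IH _ bq topq.
  by exists m.+1; rewrite iterSr /follow_pt -eq_b.
elim: p x => [|b p IH] x xp top; rewrite in_cons => /orP[/eqP->|].
- exact: from_start xp top.
- by [].
- exact: from_start xp top.
by apply: IH; case/andP: xp.
Qed.

Lemma reach_top x : x \in pts -> exists m, at_top D (iter m (follow_pt n D) x).
Proof.
case: linkD => _ [c [strands eq_c]]; rewrite -(perm_mem eq_c).
case/flattenP=> s /strands[i [j [p [-> follow_p last_p]]]].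
by apply: follows_reach_top follow_p _; rewrite last_p /at_top.
Qed.

(** This is where closed components are excluded: the points are covered by
    strands that end on the top line, so the number of steps needed to reach it
    is finite everywhere. *)
Lemma rank_exists : exists r : lpoint -> nat, forall x, x \in pts ->
  ~~ at_top D x -> (r (follow_pt n D x) < r x)%N.
Proof.
pose r x := if pselect (exists m, at_top D (iter m (follow_pt n D) x)) is left e
            then ex_minn e else 0%N.
exists r => x xP xt; rewrite {2}/r.
case: pselect => [e|]; last by move/reach_top: xP.
case: ex_minnP => -[|m]; first by rewrite /= (negbTE xt).
rewrite iterSr /r => top_m _; case: pselect => // e'.
by case: ex_minnP => k _ /(_ m top_m).
Qed.

Lemma near1_inv (d : R) : 0 < d ->
  (\forall t \near (1 : R),
     [/\ t != 0, `|1 - t| <= d & `|1 - t^-1| <= d])%classic.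
Proof.
move=> d0; pose e : R := Num.min (1 / 2) (d / 2).
have e0 : 0 < e by rewrite /e lt_min; apply/andP; split; lra.
have [e1 e2] : e <= 1 / 2 /\ e <= d / 2.
  by rewrite /e; split; rewrite ge_min lexx ?orbT.
apply: filterS (nbhsx_ballx (1 : R) e e0) => t /ltW le_t.
have t_ge : 1 / 2 <= t by have := le_trans (ler_norm _) le_t; lra.
have t0 : t != 0 by apply: lt0r_neq0; lra.
split=> //; first by lra.
have -> : 1 - t^-1 = (t - 1) / t by field.
rewrite normrM distrC normfV (ger0_norm (_ : 0 <= t)); last by lra.
by rewrite ler_pdivrMr; nra.
Qed.

Definition contracting (t : R) (h : lpoint -> R) : Prop :=
  (forall x, x \in pts -> 1 <= h x) /\
  (forall x, x \in pts ->
     \sum_(y <- pts) `|transition n D t x y| * h y <= 3 / 4 * h x).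

(** One step along the strand halves h = 2^r and has a weight of at most 9/8,
    while the weight of a switch times the largest value of h is at most 1/8;
    as h is at least 1, the total is at most 9/16 + 1/8 times h. *)
Lemma contracting_near1 : exists h,
  (\forall t \near (1 : R), t != 0 /\ contracting t h)%classic.
Proof.
have [r r_lt] := rank_exists.
pose h x : R := 2 ^+ r x; exists h.
have h1 x : 1 <= h x by rewrite exprn_ege1 // ler1n.
have h0 x : 0 <= h x by apply: le_trans (h1 x).
have [H H0 hH] : exists2 H, 0 <= H & forall x, x \in pts -> h x <= H.
  exists (\sum_(x <- pts) h x) => [|x xP]; first exact: sumr_ge0.
  by rewrite (bigD1_seq x) ?points_uniq //= lerDl sumr_ge0.
(* Both d <= 1/8 and d * H <= 1/8 are needed. *)
pose d : R := (8 * (1 + H))^-1.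
have d0 : 0 < d by rewrite invr_gt0; lra.
have dH : d * (1 + H) = 1 / 8 by rewrite /d; field; apply: lt0r_neq0; lra.
have d8 : d <= 1 / 8 by rewrite -dH (ler_peMr (ltW d0)) // lerDl.
apply: filterS (near1_inv d0) => t [t0 dt dt']; split=> //; split=> // x xP.
pose w := crossing_weight n D t x.
have dw : `|1 - w| <= d by rewrite /w /crossing_weight /over_weight; case: ifP.
pose a : R := if overcrosses n D x then w else 1.
have a_le : `|a| <= 9 / 8.
  rewrite /a; case: ifP => _; last by rewrite normr1; lra.
  have -> : w = 1 - (1 - w) by rewrite opprB addrC subrK.
  apply: le_trans (ler_normB _ _) _; rewrite normr1; lra.
apply: (@le_trans _ _ (\sum_(y <- pts)
    ((if follows n D x y then `|a| else 0)
     + (if switches n D x y then `|1 - w| else 0)) * h y)).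
  apply: ler_sum => y _; apply: ler_wpM2r => //; rewrite /transition -/w -/a.
  apply: le_trans (ler_normD _ _) _.
  by apply: lerD; case: ifP; rewrite ?normr0.
rewrite (sum_steps tangleD) //; have hx := h1 x.
have sw_le : (if overcrosses n D x then `|1 - w| * h (switch_pt n D x) else 0)
    <= 1 / 8.
  case: ifP => [ov|_]; last by lra.
  apply: (@le_trans _ _ (d * H)); last by rewrite -dH mulrDr mulr1 lerDr ltW.
  by apply: ler_pM => //; apply/hH/switch_pt_mem.
case: (boolP (at_top D x)) => [xt|xt] /=.
  by rewrite add0r; apply: le_trans sw_le _; lra.
have fol_le : 2 * h (follow_pt n D x) <= h x.
  by rewrite -exprS ler_weXn2l ?ler1n // r_lt.
apply: le_trans (lerD (ler_wpM2r (h0 _) a_le) sw_le) _; lra.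
Qed.

(** A row vector v fixed by A has |v| h <= |v| |A| h <= (3/4) |v| h. *)
Lemma contracting_unit (t : R) h : contracting t h ->
  \det (1%:M - transition_mx n D t) != 0.
Proof.
case=> h1 h_contr; apply/det0P => -[v v0 vA].
have h0 x : x \in pts -> 0 <= h x by move=> /h1; apply: le_trans.
have {}vA k : v 0 k = \sum_m v 0 m * transition n D t (pt m) (pt k).
  have /eqP := vA; rewrite mulmxBr mulmx1 subr_eq0 => /eqP/matrixP/(_ 0 k).
  by rewrite mxE => ->; apply: eq_bigr => m _; rewrite mxE.
pose S := \sum_k `|v 0 k| * h (pt k).
have S_le : S <= 3 / 4 * S.
  apply: (@le_trans _ _ (\sum_k \sum_m
      `|v 0 m| * (`|transition n D t (pt m) (pt k)| * h (pt k)))).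
    apply: ler_sum => k _; rewrite vA.
    under [leRHS]eq_bigr do rewrite mulrA -normrM.
    by rewrite -mulr_suml ler_wpM2r ?ler_norm_sum // h0 ?pt_mem.
  rewrite exchange_big /= mulr_sumr; apply: ler_sum => m _.
  rewrite -mulr_sumr mulrCA; apply: ler_wpM2l => //.
  rewrite (sum_pt n D (fun y => `|transition n D t (pt m) y| * h y)).
  by apply: h_contr; apply: pt_mem.
have S_terms k : 0 <= `|v 0 k| * h (pt k) by rewrite mulr_ge0 // h0 ?pt_mem.
have S0 : S = 0 by apply/eqP; rewrite eq_le sumr_ge0 // andbT; lra.
case/eqP: v0; apply/matrixP => i k; rewrite ord1 mxE.
have /eqP := S0; rewrite psumr_eq0 // => /allP/(_ k (mem_index_enum k)).
rewrite mulf_eq0 normr_eq0 => /orP[/eqP //|/eqP hk].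
by have := h1 _ (pt_mem k); rewrite hk; lra.
Qed.

End Contraction.

(** * Rational functions are determined by their values near 1 *)

Section RationalFunctions.
Variable R : realType.

Lemma poly_near0 (P : {poly R}) :
  (\forall t \near (1 : R), P.[t] = 0)%classic -> P = 0.
Proof.
case/nbhs_ballP => e /= e0 sub; apply/eqP/negP => /negP P0.
pose s := [seq 1 + e / i.+2%:R | i <- iota 0 (size P)].
have := max_poly_roots P0 (_ : all (root P) s) (_ : uniq s).
rewrite size_map size_iota ltnn => contra; suff: false by []; apply: contra.
  apply/allP => _ /mapP[i _ ->]; apply/eqP/sub; rewrite /ball /= opprD addNKr.
  rewrite normrN ger0_norm ?divr_ge0 ?(ltW e0) // ltr_pdivrMr ?ltr0n //.
  by rewrite ltr_pMr // ltr1n.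
rewrite map_inj_uniq ?iota_uniq // => i j /addrI /(mulfI (lt0r_neq0 e0)).
by move/invr_inj/eqP; rewrite eqr_nat => /eqP[].
Qed.

Lemma eval_near1_uniq (f f' : ratfun) (g : R -> R -> Prop) :
  (forall t s s', g t s -> g t s' -> s = s') ->
  eval_near1 f g -> eval_near1 f' g -> f = f'.
Proof.
move=> g_fun [p [q [-> near_pq]]] [p' [q' [-> near_pq']]].
have nz (u : {poly rat}) (G : R -> Prop) :
    (\forall t \near (1 : R), (map_poly ratr u).[t] != 0 /\ G t)%classic ->
    u != 0.
  move=> /filter_ex[t [ut _]]; apply: contraNneq ut => ->.
  by rewrite rmorph0 horner0.
have q0 := nz _ _ near_pq; have q'0 := nz _ _ near_pq'.
apply/eqP; rewrite eqr_div ?tofrac_eq0 //.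
rewrite -!tofracM; apply/eqP; congr (tofrac _).
apply: (map_poly_inj (@ratr R)).
apply/eqP; rewrite -subr_eq0; apply/eqP; apply: poly_near0.
apply: filterS2 near_pq near_pq' => t [qt gt] [qt' gt'].
apply/eqP; rewrite hornerD hornerN subr_eq0 !rmorphM !hornerM.
by rewrite -eqr_div // (g_fun _ _ _ gt gt').
Qed.

End RationalFunctions.

(** * The random walk matrix *)

Section RandomWalk.
Variables (R : realType) (n : nat) (D : diagram).
Hypothesis linkD : string_link n D.
Let tangleD : tangle_diagram n D. Proof. by case: linkD. Qed.

Lemma path_sum_cvg_uniq (t : R) i j s s' :
  path_sum_cvg n D t i j s -> path_sum_cvg n D t i j s' -> s = s'.
Proof. exact: (norm_cvg_unique (V := R)). Qed.

Definition eval_at (t : R) : {rmorphism {poly rat} -> R} :=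
  horner_eval t \o map_poly (@ratr R).

Lemma eval_atX t : eval_at t 'X = t.
Proof. by rewrite /eval_at /= /horner_eval map_polyX hornerX. Qed.

Lemma green_den_at (t : R) h : t != 0 -> contracting n D t h ->
  eval_at t (green_den n D) != 0.
Proof.
move=> t0 contr; rewrite -det_map_mx map_poly_mx eval_atX //.
by rewrite detZ mulf_neq0 ?expf_neq0 // (contracting_unit contr).
Qed.

Definition walk_mx : 'M[ratfun]_n := \matrix_(j, i)
  (@FracField.tofrac {poly rat} (green_num n D (0%N, val i) (size D, val j))
   / @FracField.tofrac {poly rat} (green_den n D)).

Lemma walk_mxP : is_random_walk R D walk_mx.
Proof.
move=> j i; rewrite mxE; exists (green_num n D (0%N, val i) (size D, val j)).
exists (green_den n D); split=> //.
have [h near_h] := contracting_near1 R linkD.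
apply: filterS near_h => t [t0 contr].
have q0 := green_den_at t0 contr; split=> //.
have -> : (map_poly ratr (green_num n D (0%N, val i) (size D, val j))).[t]
   / (map_poly ratr (green_den n D)).[t]
   = green (green_mx n D (eval_at t)) (0%N, val i) (size D, val j).
  by rewrite -green_ratio.
have [h1 h_contr] := contr.
have tX : eval_at t 'X != 0 by rewrite eval_atX.
apply: (path_sum_green tangleD h1 h_contr
  (g := green (green_mx n D (eval_at t)) ^~ (size D, val j))).
  exact: bottom_mem.
move=> y yP; have GK := green_mxK tX q0; rewrite {1}eval_atX in GK.
exact: (greenE GK).
Qed.

Lemma random_walkE : random_walk R n D = walk_mx.
Proof.
have rwP : is_random_walk R D (random_walk R n D).
  exact: (@xgetI _ 0 [set M | is_random_walk R D M]%classic _ walk_mxP).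
 apply/matrixP => j i.
apply: eval_near1_uniq (rwP j i) (walk_mxP j i) => t s s'.
exact: path_sum_cvg_uniq.
Qed.

Lemma walk_mx_eigen : evec n *m walk_mx = evec n /\ walk_mx *m vvec n = vvec n.
Proof.
pose phi : {rmorphism {poly rat} -> ratfun} := @FracField.tofrac {poly rat}.
have X0 : phi 'X != 0 by rewrite tofrac_eq0 polyX_eq0.
have den0 : phi (green_den n D) != 0.
  rewrite tofrac_eq0.
  have [h /filter_ex[t [t0 contr]]] := contracting_near1 R linkD.
  by apply: contraNneq (green_den_at t0 contr) => ->; rewrite rmorph0.
have GK := green_mxK X0 den0.
have mxE' j i :
    walk_mx j i = green (green_mx n D phi) (0%N, val i) (size D, val j).
  by rewrite mxE -green_ratio.
split; apply/matrixP => a b; rewrite !mxE.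
  rewrite -(green_top tangleD GK (bottom_mem D b)); apply: eq_bigr => j _.
  by rewrite mxE' mxE mul1r.
rewrite -(green_bottom tangleD X0 GK a); apply: eq_bigr => i _.
by rewrite mxE' mxE.
Qed.

End RandomWalk.

Theorem corollary8 (R : realType) (n : nat) (T : diagram)
    (hT : string_link n T) :
  evec n *m random_walk R n T = evec n /\
  random_walk R n T *m vvec n = vvec n.
Proof. by rewrite random_walkE //; apply: walk_mx_eigen. Qed.
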